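(* Let $m\ge 2$ be an integer, let $R$ be a ring and let $a\in R$ be strongly $\pi$-regular with strongly $\pi$-regular decomposition $a=f+u$. Then $a$ is a strongly $m$-nil clean element of $R$ if and only if there exists an $m$-potent $g\in R$ commuting with $f$ and $u$ such that $f-g+u$ is nilpotent.
   Context: Rings are associative with identity. An element $g$ is $m$-potent if $g^m=g$. An element $a\in R$ is strongly $m$-nil clean if $a=g+n$ with $g$ an $m$-potent, $n$ a nilpotent and $gn=ng$. A strongly $\pi$-regular decomposition of $a\in R$ is an expression $a=f+u$ with $f$ an idempotent and $u$ a unit of $R$ such that $af=fa$ and $faf$ is nilpotent; $a$ is strongly $\pi$-regular if it admits such a decomposition. *)

(* Defs.v *)
From mathcomp Require Import all_boot all_algebra.

Set Implicit Arguments.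
Unset Strict Implicit.
Unset Printing Implicit Defensive.

Import GRing.Theory.
Local Open Scope ring_scope.

(* pzRingType is the library's class of associative rings with identity; it
   allows the zero ring. *)

Definition nilpotent_elt (R : pzRingType) (x : R) : Prop :=
  exists k : nat, x ^+ k = 0.

Definition idempotent_elt (R : pzRingType) (f : R) : Prop := f * f = f.

(* GRing.unit is not used: it requires a unitRingType, i.e., a nonzero ring
   with decidable invertibility. *)
Definition unit_elt (R : pzRingType) (u : R) : Prop :=
  exists v : R, v * u = 1 /\ u * v = 1.

Definition mpotent (R : pzRingType) (m : nat) (g : R) : Prop := g ^+ m = g.

Definition strongly_mnil_clean (R : pzRingType) (m : nat) (a : R) : Prop :=
  exists g n : R,
    [/\ mpotent m g, nilpotent_elt n, a = g + n & GRing.comm g n].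

Definition strongly_pi_regular_decomp (R : pzRingType) (a f u : R) : Prop :=
  [/\ a = f + u, idempotent_elt f, unit_elt u, GRing.comm a f
    & nilpotent_elt (f * a * f)].

Definition strongly_pi_regular (R : pzRingType) (a : R) : Prop :=
  exists f u : R, strongly_pi_regular_decomp a f u.

(* Main.v *)
Require Import Defs.
From mathcomp Require Import all_boot all_algebra.

Set Implicit Arguments.
Unset Strict Implicit.
Unset Printing Implicit Defensive.

Import GRing.Theory.
Local Open Scope ring_scope.

(** Since f + u = a, the element f - g + u is just the nilpotent part a - g, so
    both sides speak of an m-potent g with a - g nilpotent; they differ only in
    what g has to commute with.  If g commutes with f and u, it commutes with
    a, hence with a - g.  Conversely, if a = g + n with g n = n g, then g
    commutes with a, and the point is that f lies in the double commutant of a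
    ([strongly_pi_regular_decomp_comm]): f is the Fitting idempotent of a,
    because a is nilpotent on the corner of f and invertible on the corner of
    1 - f.  So g commutes with f, and with u = a - f. *)

(** The Fitting decomposition for a: a large power of a is killed by f, while
    on the corner of 1 - f one has a (1 - f) = u (1 - f), so there the powers
    of a are inverted by those of the inverse of u. *)
Lemma strongly_pi_regular_decomp_fitting (R : pzRingType) (a f u : R) :
  strongly_pi_regular_decomp a f u ->
  exists k w w', [/\ a ^+ k * f = 0, f * a ^+ k = 0,
                     a ^+ k * w = 1 - f & w' * a ^+ k = 1 - f].
Proof.
case=> a_fu ff [v [vu uv]] caf [k nil_faf].
have cakf j : GRing.comm (a ^+ j) f by apply/commr_sym/commrX/commr_sym.
have fXf j : f ^+ j * f = f.
  by elim: j => [|j IHj]; rewrite ?expr0 ?mul1r // exprS -mulrA IHj.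
have akf : a ^+ k * f = 0.
  have fafE : f * a * f = a * f by rewrite -caf -mulrA ff.
  by rewrite -[f in LHS](fXf k) mulrA -exprMn_comm // -fafE nil_faf mul0r.
have af' : a * (1 - f) = u * (1 - f).
  by rewrite {1}a_fu mulrDl [f * _]mulrBr mulr1 ff subrr add0r.
have caf' : GRing.comm a (1 - f) by apply: commrB; [exact: commr1|].
have cuf' : GRing.comm u (1 - f).
  have -> : u = a - f by rewrite a_fu addrC addKr.
  apply/commr_sym/commrB; first exact/commr_sym.
  by apply/commr_sym/commrB; [exact: commr1|].
have aXf' j : a ^+ j * (1 - f) = u ^+ j * (1 - f).
  elim: j => [//|j IHj].
  by rewrite !exprSr -!mulrA af' cuf' !mulrA IHj.
have cuv : GRing.comm u v by rewrite /GRing.comm uv vu.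
exists k, ((1 - f) * v ^+ k), (v ^+ k * (1 - f)); split=> //.
- by rewrite -cakf.
- have cukf' : GRing.comm (1 - f) (u ^+ k) by apply/commrX/commr_sym.
  by rewrite mulrA aXf' -cukf' -mulrA -exprMn_comm // uv expr1n mulr1.
- have cakf' : GRing.comm (1 - f) (a ^+ k) by apply/commrX/commr_sym.
  rewrite -mulrA cakf' aXf' mulrA -exprMn_comm; last exact/commr_sym.
  by rewrite vu expr1n mul1r.
Qed.

(** If x commutes with a, sliding a power of a across x kills both off-diagonal
    Peirce components f x (1 - f) and (1 - f) x f, which says f x = x f. *)
Lemma strongly_pi_regular_decomp_comm (R : pzRingType) (a f u x : R) :
  strongly_pi_regular_decomp a f u -> GRing.comm x a -> GRing.comm x f.
Proof.
move=> /strongly_pi_regular_decomp_fitting [k [w [w' [akf fak aw wa]]]] cxa.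
have cxak : GRing.comm x (a ^+ k) by exact: commrX.
have fxf' : f * x * (1 - f) = 0.
  by rewrite -aw -mulrA [x * _]mulrA cxak !mulrA fak !mul0r.
have f'xf : (1 - f) * x * f = 0.
  by rewrite -wa -!mulrA [a ^+ k * _]mulrA -cxak -mulrA akf !mulr0.
have fxE : f * x = f * x * f.
  by apply/eqP; rewrite -subr_eq0 -{1}[f * x]mulr1 -mulrBr fxf'.
have xfE : x * f = f * x * f.
  by apply/eqP; rewrite -subr_eq0 -{1}[x]mul1r -!mulrBl f'xf.
by rewrite /GRing.comm xfE -fxE.
Qed.

Theorem proposition3p21 (m : nat) (hm : (2 <= m)%N) (R : pzRingType)
    (a f u : R) (ha : strongly_pi_regular a)
    (hdec : strongly_pi_regular_decomp a f u) :
  strongly_mnil_clean m a <->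
  exists g : R, [/\ mpotent m g, GRing.comm g f, GRing.comm g u
                  & nilpotent_elt (f - g + u)].
Proof.
have a_fu : a = f + u by case: hdec.
have partE g : f - g + u = a - g by rewrite a_fu addrAC.
split=> [[g [n [g_mpot n_nil a_gn cgn]]] | [g [g_mpot cgf cgu n_nil]]].
- have cga : GRing.comm g a by rewrite a_gn; apply: commrD.
  have cgf := strongly_pi_regular_decomp_comm hdec cga.
  exists g; split=> //; last by rewrite partE a_gn addrC addKr.
  have -> : u = a - f by rewrite a_fu addrC addKr.
  exact: commrB.
- rewrite partE in n_nil.
  exists g, (a - g); split=> //; first by rewrite addrC subrK.
  by apply: commrB => //; rewrite a_fu; apply: commrD.
Qed.
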